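(* (1) Cofibrant approximation functors $t:\mathcal M'\to\mathcal M$ (of precofibration categories $\mathcal M$) are left approximations. (2) Fibrant approximation functors $t:\mathcal M'\to\mathcal M$ (of prefibration categories $\mathcal M$) are right approximations.
   Context: **Precofibration categories.** A precofibration category $(\mathcal M,\mathcal W,\mathrm{Cof})$ is a category $\mathcal M$ with two classes of maps, weak equivalences $\mathcal W$ and cofibrations $\mathrm{Cof}$ (a trivial cofibration is a map in both; $A$ is cofibrant if $\mathbf 0\to A$ is a cofibration, $\mathbf 0$ the initial object), such that: CF1: $\mathcal M$ has an initial object $\mathbf 0$, which is cofibrant; cofibrations are stable under composition; all isomorphisms are weak equivalences, and all isomorphisms with cofibrant domain are trivial cofibrations. CF2: if $gf$ is defined and two of $f,g,gf$ are weak equivalences, so is the third. CF3: for a cofibration $i:A\to B$ and a map $A\to C$ with $A,C$ cofibrant, (1) the pushout of $i$ along $A\to C$ exists and $C\to B\sqcup_A C$ is a cofibration; (2) if $i$ is a trivial cofibration, so is $C\to B\sqcup_A C$. CF4: any map $f:A\to B$ with $A$ cofibrant factors as $f=rf'$ with $f'$ a cofibration and $r$ a weak equivalence. $(\mathcal M,\mathcal W,\mathrm{Fib})$ is a prefibration category if $(\mathcal M^{op},\mathcal W^{op},\mathrm{Fib}^{op})$ is a precofibration category. **Cofibrant approximations.** For a precofibration category $\mathcal M$, a functor $t:\mathcal M'\to\mathcal M$ is a cofibrant approximation if $\mathcal M'$ is a precofibration category with all objects cofibrant and: CFA1: $t$ preserves the initial object and cofibrations; CFA2: a map $f$ of $\mathcal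 M'$ is a weak equivalence iff $tf$ is; CFA3: if $A\to B$, $A\to C$ are cofibrations of $\mathcal M'$, the natural map $tB\sqcup_{tA}tC\to t(B\sqcup_AC)$ is an isomorphism; CFA4: any map $f:tA\to B$ factors as $f=r\circ tf'$ with $f'$ a cofibration of $\mathcal M'$ and $r$ a weak equivalence of $\mathcal M$. For a prefibration category $\mathcal M$, $t:\mathcal M'\to\mathcal M$ is a fibrant approximation if $t^{op}:\mathcal M'^{op}\to\mathcal M^{op}$ is a cofibrant approximation. **Left/right approximations.** $\mathbf{ho}\mathcal M=\mathcal M[\mathcal W^{-1}]$. A functor $t:\mathcal M'\to\mathcal M$ with $t(\mathcal W')\subset\mathcal W$ is a left approximation if: LAP1: for any object $A\in\mathcal M$ there are an object $A'\in\mathcal M'$ and a weak equivalence $tA'\to A$. LAP2: for any objects $A',B'\in\mathcal M'$, $B\in\mathcal M$, any map $f:tA'\to B$ in $\mathcal M$ and any $p:tB'\to B$ in $\mathcal W$: (1) there exist maps $i':A'\to D'$ and $j':B'\to D'$ in $\mathcal M'$ with $j'\in\mathcal W'$, and a weak equivalence $\sigma:tD'\to B$ in $\mathcal W$, with $\sigma\circ ti'=f$ and $\sigma\circ tj'=p$; (2) for any other such $i'',j'',\sigma''$ (with some object $D''$), one has $j'^{-1}i'=j''^{-1}i''$ in $\mathbf{ho}\mathcal M'$. It is a right approximation if $t^{op}:\mathcal M'^{op}\to\mathcal M^{op}$ is a left approximation. *)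

(* Defs.v *)
From Stdlib Require Import FunctionalExtensionality PropExtensionality.
From Stdlib Require Import ProofIrrelevance IndefiniteDescription.

Set Implicit Arguments.
Unset Strict Implicit.
Unset Printing Implicit Defensive.

Record Category := {
  Ob :> Type;
  Hom : Ob -> Ob -> Type;
  idm : forall a, Hom a a;
  comp : forall a b c, Hom b c -> Hom a b -> Hom a c;
  comp_idl : forall a b (f : Hom a b), comp (idm b) f = f;
  comp_idr : forall a b (f : Hom a b), comp f (idm a) = f;
  comp_assoc : forall a b c d (h : Hom c d) (g : Hom b c) (f : Hom a b),
    comp h (comp g f) = comp (comp h g) f
}.

Arguments Hom {_} _ _.
Arguments idm {_} _.

Declare Scope cat_scope.
Delimit Scope cat_scope with cat.
Notation "g \c f" := (comp g f) (at level 40, left associativity) : cat_scope.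
Open Scope cat_scope.

Definition op (C : Category) : Category := {|
  Ob := Ob C;
  Hom := fun a b => @Hom C b a;
  idm := fun a => @idm C a;
  comp := fun a b c g f => @comp C c b a f g;
  comp_idl := fun a b f => @comp_idr C b a f;
  comp_idr := fun a b f => @comp_idl C b a f;
  comp_assoc := fun a b c d h g f => eq_sym (@comp_assoc C d c b a f g h)
|}.

Record Functor (C D : Category) := {
  fob :> C -> D;
  fhom : forall a b : C, Hom a b -> Hom (fob a) (fob b);
  fhom_id : forall a : C, fhom (idm a) = idm (fob a);
  fhom_comp : forall (a b c : C) (g : Hom b c) (f : Hom a b),
    fhom (g \c f) = fhom g \c fhom f
}.

Arguments fhom {C D} _ {a b} _.

Definition fop (C D : Category) (F : Functor C D) : Functor (op C) (op D) := {|
  fob := fun a : op C => (F a : op D);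
  fhom := fun (a b : op C) (f : @Hom (op C) a b) => @fhom C D F b a f;
  fhom_id := fun a => @fhom_id C D F a;
  fhom_comp := fun a b c g f => @fhom_comp C D F c b a f g
|}.

Definition fcomp (C D E : Category) (G : Functor D E) (F : Functor C D) :
  Functor C E.
Proof.
  refine {| fob := fun a => G (F a);
            fhom := fun a b f => fhom G (fhom F f) |}.
  - intros a. rewrite fhom_id. apply fhom_id.
  - intros a b c g f. rewrite fhom_comp. apply fhom_comp.
Defined.

Definition is_iso (C : Category) (a b : C) (f : Hom a b) : Prop :=
  exists g : Hom b a, g \c f = idm a /\ f \c g = idm b.

Definition initial (C : Category) (o : C) : Prop :=
  forall a : C, exists! f : Hom o a, True.

(** [b --p--> d <--q-- c] is a pushout of [b <--f-- a --g--> c]. *)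
Definition is_pushout (C : Category) (a b c d : C)
    (f : Hom a b) (g : Hom a c) (p : Hom b d) (q : Hom c d) : Prop :=
  p \c f = q \c g /\
  forall (x : C) (u : Hom b x) (v : Hom c x), u \c f = v \c g ->
    exists! w : Hom d x, w \c p = u /\ w \c q = v.

Definition mor_class (C : Category) := forall a b : C, Hom a b -> Prop.

Definition op_class (C : Category) (W : mor_class C) : mor_class (op C) :=
  fun a b f => W b a f.

Arguments op_class {C} W a b f.

(** The localization [C[W^-1]]:
    it has the objects of [C]; its morphisms are the formal composites of
    morphisms of [C] and formal inverses of morphisms of [W], modulo the
    congruence generated by the category laws, the composition of [C], and the
    relations making the formal inverses two-sided inverses. *)

Section Localization.
Variables (C : Category) (W : mor_class C).
Arguments W : clear implicits.

Inductive loc_term : C -> C -> Type :=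
| loc_map a b (f : Hom a b) : loc_term a b
| loc_inv a b (s : Hom a b) (Ws : W _ _ s) : loc_term b a
| loc_comp a b c (y : loc_term b c) (x : loc_term a b) : loc_term a c.

Inductive loc_eq : forall a b, loc_term a b -> loc_term a b -> Prop :=
| le_refl a b (x : loc_term a b) : loc_eq x x
| le_sym a b (x y : loc_term a b) : loc_eq x y -> loc_eq y x
| le_trans a b (x y z : loc_term a b) : loc_eq x y -> loc_eq y z -> loc_eq x z
| le_cong a b c (y y' : loc_term b c) (x x' : loc_term a b) :
    loc_eq y y' -> loc_eq x x' -> loc_eq (loc_comp y x) (loc_comp y' x')
| le_idl a b (x : loc_term a b) : loc_eq (loc_comp (loc_map (idm b)) x) x
| le_idr a b (x : loc_term a b) : loc_eq (loc_comp x (loc_map (idm a))) x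
| le_assoc a b c d (z : loc_term c d) (y : loc_term b c) (x : loc_term a b) :
    loc_eq (loc_comp z (loc_comp y x)) (loc_comp (loc_comp z y) x)
| le_map a b c (g : Hom b c) (f : Hom a b) :
    loc_eq (loc_comp (loc_map g) (loc_map f)) (loc_map (g \c f))
| le_invl a b (s : Hom a b) (Ws : W _ _ s) :
    loc_eq (loc_comp (loc_inv Ws) (loc_map s)) (loc_map (idm a))
| le_invr a b (s : Hom a b) (Ws : W _ _ s) :
    loc_eq (loc_comp (loc_map s) (loc_inv Ws)) (loc_map (idm b)).

Definition ho_hom (a b : C) : Type :=
  {P : loc_term a b -> Prop | exists x, P = loc_eq x}.

Definition cls (a b : C) (x : loc_term a b) : ho_hom a b :=
  exist _ (loc_eq x) (ex_intro _ x eq_refl).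

Lemma cls_eq a b (x y : loc_term a b) : loc_eq x y -> cls x = cls y.
Proof.
  intros e. apply subset_eq_compat. extensionality z.
  apply propositional_extensionality; split; intros h.
  - exact (le_trans (le_sym e) h).
  - exact (le_trans e h).
Qed.

Lemma cls_inj a b (x y : loc_term a b) : cls x = cls y -> loc_eq x y.
Proof.
  intros e. change (proj1_sig (cls x) y). rewrite e. apply le_refl.
Qed.

Lemma cls_surj a b (X : ho_hom a b) : exists x, X = cls x.
Proof.
  destruct X as [P hP]. destruct hP as [x e].
  exists x. now apply subset_eq_compat.
Qed.

Lemma ho_comp_spec a b c (Y : ho_hom b c) (X : ho_hom a b) :
  exists z, (fun w => exists y x,
    proj1_sig Y y /\ proj1_sig X x /\ loc_eq (loc_comp y x) w) = loc_eq z.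
Proof.
  destruct (cls_surj Y) as [y ->]. destruct (cls_surj X) as [x ->].
  exists (loc_comp y x). extensionality w.
  apply propositional_extensionality; split.
  - intros [y' [x' [ey [ex e]]]]. exact (le_trans (le_cong ey ex) e).
  - intros e. exists y, x. repeat split; trivial; apply le_refl.
Qed.

Definition ho_comp (a b c : C) (Y : ho_hom b c) (X : ho_hom a b) : ho_hom a c :=
  exist _ _ (ho_comp_spec Y X).

Lemma ho_comp_cls a b c (y : loc_term b c) (x : loc_term a b) :
  ho_comp (cls y) (cls x) = cls (loc_comp y x).
Proof.
  apply subset_eq_compat. extensionality w.
  apply propositional_extensionality; split.
  - intros [y' [x' [ey [ex e]]]]. exact (le_trans (le_cong ey ex) e).
  - intros e. exists y, x. repeat split; trivial; apply le_refl.
Qed.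

Lemma ho_idl a b (X : ho_hom a b) : ho_comp (cls (loc_map (idm b))) X = X.
Proof.
  destruct (cls_surj X) as [x ->].
  rewrite ho_comp_cls. apply cls_eq, le_idl.
Qed.

Lemma ho_idr a b (X : ho_hom a b) : ho_comp X (cls (loc_map (idm a))) = X.
Proof.
  destruct (cls_surj X) as [x ->].
  rewrite ho_comp_cls. apply cls_eq, le_idr.
Qed.

Lemma ho_assoc a b c d (Z : ho_hom c d) (Y : ho_hom b c) (X : ho_hom a b) :
  ho_comp Z (ho_comp Y X) = ho_comp (ho_comp Z Y) X.
Proof.
  destruct (cls_surj Z) as [z ->]. destruct (cls_surj Y) as [y ->].
  destruct (cls_surj X) as [x ->].
  rewrite !ho_comp_cls. apply cls_eq, le_assoc.
Qed.

Definition ho : Category := {|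
  Ob := Ob C;
  Hom := ho_hom;
  idm := fun a => cls (loc_map (idm a));
  comp := ho_comp;
  comp_idl := ho_idl;
  comp_idr := ho_idr;
  comp_assoc := ho_assoc
|}.

Lemma ho_loc_comp a b c (g : Hom b c) (f : Hom a b) :
  cls (loc_map (g \c f)) = ho_comp (cls (loc_map g)) (cls (loc_map f)).
Proof. rewrite ho_comp_cls. symmetry. apply cls_eq, le_map. Qed.

Definition ho_loc : Functor C ho := {|
  fob := fun a : C => (a : ho);
  fhom := fun a b f => (cls (loc_map f) : @Hom ho a b);
  fhom_id := fun a => eq_refl;
  fhom_comp := ho_loc_comp
|}.

Definition ho_inv (a b : C) (s : Hom a b) (Ws : W _ _ s) :
  Hom (ho_loc b) (ho_loc a) := cls (loc_inv Ws).

Lemma ho_invl a b (s : Hom a b) (Ws : W _ _ s) :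
  ho_inv Ws \c fhom ho_loc s = idm (ho_loc a).
Proof. cbn. unfold ho_inv. rewrite ho_comp_cls. apply cls_eq, le_invl. Qed.

Lemma ho_invr a b (s : Hom a b) (Ws : W _ _ s) :
  fhom ho_loc s \c ho_inv Ws = idm (ho_loc b).
Proof. cbn. unfold ho_inv. rewrite ho_comp_cls. apply cls_eq, le_invr. Qed.

Section UniversalProperty.
Variables (D : Category) (F : Functor C D).
Hypothesis FW : forall a b (s : Hom a b), W _ _ s -> is_iso (fhom F s).

Definition iso_inv (a b : D) (f : Hom a b) (h : is_iso f) : Hom b a :=
  proj1_sig (constructive_indefinite_description _ h).

Lemma iso_invP (a b : D) (f : Hom a b) (h : is_iso f) :
  iso_inv h \c f = idm a /\ f \c iso_inv h = idm b.
Proof. exact (proj2_sig (constructive_indefinite_description _ h)). Qed.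

Fixpoint term_eval (a b : C) (x : loc_term a b) : Hom (F a) (F b) :=
  match x with
  | loc_map f => fhom F f
  | loc_inv Ws => iso_inv (FW Ws)
  | loc_comp y x => term_eval y \c term_eval x
  end.

Lemma term_eval_eq a b (x y : loc_term a b) :
  loc_eq x y -> term_eval x = term_eval y.
Proof.
  induction 1; cbn; try congruence.
  - now rewrite fhom_id, comp_idl.
  - now rewrite fhom_id, comp_idr.
  - apply comp_assoc.
  - symmetry. apply fhom_comp.
  - rewrite fhom_id. apply iso_invP.
  - rewrite fhom_id. apply iso_invP.
Qed.

Definition ho_rep (a b : C) (X : ho_hom a b) : loc_term a b :=
  proj1_sig (constructive_indefinite_description _ (cls_surj X)).

Lemma ho_rep_cls a b (x : loc_term a b) : loc_eq (ho_rep (cls x)) x.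
Proof.
  apply cls_inj. symmetry.
  exact (proj2_sig (constructive_indefinite_description _ (cls_surj (cls x)))).
Qed.

Definition ho_lift : Functor ho D.
Proof.
  refine {| fob := fun a : ho => F a;
            fhom := fun (a b : ho) X => term_eval (@ho_rep a b X) |}.
  - intros a. cbn. rewrite (term_eval_eq (ho_rep_cls _)). apply fhom_id.
  - intros a b c Y X. destruct (cls_surj Y) as [y ->].
    destruct (cls_surj X) as [x ->]. cbn. rewrite ho_comp_cls.
    now rewrite !(term_eval_eq (ho_rep_cls _)).
Defined.

End UniversalProperty.

Lemma functor_eq (A B : Category) (o : A -> B)
    (m m' : forall a b : A, Hom a b -> Hom (o a) (o b)) i i' c c' :
  (forall a b (f : Hom a b), m a b f = m' a b f) ->
  @Build_Functor A B o m i c = @Build_Functor A B o m' i' c'.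
Proof.
  intros e. assert (m = m') as E.
  { extensionality a; extensionality b; extensionality f. apply e. }
  subst m'. f_equal; apply proof_irrelevance.
Qed.

Theorem ho_universal (D : Category) (F : Functor C D) :
  (forall a b (s : Hom a b), W _ _ s -> is_iso (fhom F s)) ->
  exists! G : Functor ho D, fcomp G ho_loc = F.
Proof.
  intros FW. exists (ho_lift FW). split.
  - destruct F as [o m i c]. apply functor_eq. intros a b f.
    cbn. now rewrite (term_eval_eq FW (ho_rep_cls _)).
  - intros G e. subst F. destruct G as [o m i c]. apply functor_eq.
    intros a b X. destruct (cls_surj X) as [x ->].
    rewrite (term_eval_eq FW (ho_rep_cls _)).
    induction x as [a b f|a b s Ws|a b d y IHy x IHx]; cbn.
    + reflexivity.
    + destruct (iso_invP (FW a b s Ws)) as [el er]. cbn in el, er.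
      pose proof (c _ _ _ (fhom ho_loc s) (ho_inv Ws)) as e.
      rewrite ho_invr, i in e. cbn in e.
      rewrite <- (comp_idr (iso_inv _)), e, comp_assoc, el. apply comp_idl.
    + rewrite IHy, IHx, <- ho_comp_cls. symmetry. apply (c a b d).
Qed.

End Localization.

Arguments ho {C} W.
Arguments ho_loc {C} W.
Arguments ho_inv {C} W {a b s} Ws.

(** The initial object is unique up to isomorphism only, so cofibrancy refers to
    the map out of some initial object; under the axioms below the choice is
    immaterial. *)
Definition cofibrant (C : Category) (Cof : mor_class C) (a : C) : Prop :=
  exists (o : C) (f : Hom o a), initial o /\ Cof o a f.

Record precofibration_category (C : Category) (W Cof : mor_class C) : Prop := {
  CF1_initial : exists o : C, initial o /\ cofibrant Cof o;
  CF1_comp : forall (a b c : C) (g : Hom b c) (f : Hom a b),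
    Cof _ _ f -> Cof _ _ g -> Cof _ _ (g \c f);
  CF1_iso_weq : forall (a b : C) (f : Hom a b), is_iso f -> W _ _ f;
  CF1_iso_cof : forall (a b : C) (f : Hom a b),
    is_iso f -> cofibrant Cof a -> Cof _ _ f /\ W _ _ f;
  CF2_comp : forall (a b c : C) (g : Hom b c) (f : Hom a b),
    W _ _ f -> W _ _ g -> W _ _ (g \c f);
  CF2_left : forall (a b c : C) (g : Hom b c) (f : Hom a b),
    W _ _ f -> W _ _ (g \c f) -> W _ _ g;
  CF2_right : forall (a b c : C) (g : Hom b c) (f : Hom a b),
    W _ _ g -> W _ _ (g \c f) -> W _ _ f;
  CF3_exists : forall (a b c : C) (i : Hom a b) (f : Hom a c),
    Cof _ _ i -> cofibrant Cof a -> cofibrant Cof c ->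
    exists (d : C) (p : Hom b d) (q : Hom c d), is_pushout i f p q;
  CF3_cof : forall (a b c d : C) (i : Hom a b) (f : Hom a c)
      (p : Hom b d) (q : Hom c d),
    Cof _ _ i -> cofibrant Cof a -> cofibrant Cof c ->
    is_pushout i f p q -> Cof _ _ q;
  CF3_trivial_cof : forall (a b c d : C) (i : Hom a b) (f : Hom a c)
      (p : Hom b d) (q : Hom c d),
    Cof _ _ i -> W _ _ i -> cofibrant Cof a -> cofibrant Cof c ->
    is_pushout i f p q -> Cof _ _ q /\ W _ _ q;
  CF4 : forall (a b : C) (f : Hom a b), cofibrant Cof a ->
    exists (c : C) (f' : Hom a c) (r : Hom c b),
      Cof _ _ f' /\ W _ _ r /\ f = r \c f'
}.

Definition prefibration_category (C : Category) (W Fib : mor_class C) : Prop :=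
  precofibration_category (op_class W) (op_class Fib).

Record cofibrant_approximation (C' C : Category)
    (W' Cof' : mor_class C') (W Cof : mor_class C) (t : Functor C' C) : Prop := {
  CFA_precof : precofibration_category W' Cof';
  CFA_cofibrant : forall a : C', cofibrant Cof' a;
  CFA1_initial : forall o : C', initial o -> initial (t o);
  CFA1_cof : forall (a b : C') (f : Hom a b), Cof' _ _ f -> Cof _ _ (fhom t f);
  CFA2 : forall (a b : C') (f : Hom a b), W' _ _ f <-> W _ _ (fhom t f);
  (** [w] is the natural map [tb \sqcup_{ta} tc -> t (b \sqcup_a c)], where
      [d = b \sqcup_a c] and [e = tb \sqcup_{ta} tc]. *)
  CFA3 : forall (a b c d : C') (f : Hom a b) (g : Hom a c)
      (p : Hom b d) (q : Hom c d)
      (e : C) (p1 : Hom (t b) e) (q1 : Hom (t c) e) (w : Hom e (t d)),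
    Cof' _ _ f -> Cof' _ _ g -> is_pushout f g p q ->
    is_pushout (fhom t f) (fhom t g) p1 q1 ->
    w \c p1 = fhom t p -> w \c q1 = fhom t q -> is_iso w;
  CFA4 : forall (a : C') (b : C) (f : Hom (t a) b),
    exists (a' : C') (f' : Hom a a') (r : Hom (t a') b),
      Cof' _ _ f' /\ W _ _ r /\ f = r \c fhom t f'
}.

Definition fibrant_approximation (C' C : Category)
    (W' Fib' : mor_class C') (W Fib : mor_class C) (t : Functor C' C) : Prop :=
  cofibrant_approximation (op_class W') (op_class Fib')
    (op_class W) (op_class Fib) (fop t).

Record left_approximation (C' C : Category)
    (W' : mor_class C') (W : mor_class C) (t : Functor C' C) : Prop := {
  LAP_weq : forall (a b : C') (f : Hom a b), W' _ _ f -> W _ _ (fhom t f);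
  LAP1 : forall a : C, exists (a' : C') (r : Hom (t a') a), W _ _ r;
  LAP2_exists : forall (a' b' : C') (b : C) (f : Hom (t a') b) (p : Hom (t b') b),
    W _ _ p ->
    exists (d : C') (i : Hom a' d) (j : Hom b' d) (s : Hom (t d) b),
      W' _ _ j /\ W _ _ s /\ s \c fhom t i = f /\ s \c fhom t j = p;
  LAP2_unique : forall (a' b' : C') (b : C) (f : Hom (t a') b) (p : Hom (t b') b),
    W _ _ p ->
    forall (d1 : C') (i1 : Hom a' d1) (j1 : Hom b' d1) (s1 : Hom (t d1) b)
           (d2 : C') (i2 : Hom a' d2) (j2 : Hom b' d2) (s2 : Hom (t d2) b)
           (Wj1 : W' _ _ j1) (Wj2 : W' _ _ j2),
      W _ _ s1 -> s1 \c fhom t i1 = f -> s1 \c fhom t j1 = p ->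
      W _ _ s2 -> s2 \c fhom t i2 = f -> s2 \c fhom t j2 = p ->
      ho_inv W' Wj1 \c fhom (ho_loc W') i1 = ho_inv W' Wj2 \c fhom (ho_loc W') i2
}.

Definition right_approximation (C' C : Category)
    (W' : mor_class C') (W : mor_class C) (t : Functor C' C) : Prop :=
  left_approximation (op_class W') (op_class W) (fop t).

(* Main.v *)
Require Import Defs.

(** The left approximation axioms are obtained by computing pushouts of
    cofibrations in [M'], which [t] preserves: a compatible pair of maps into
    [B] out of the images of the two legs extends to the image of the pushout,
    and CFA4 replaces the pushout by an object [F] with a weak equivalence
    [tF -> B].  Over the initial object this gives existence in LAP2.  For
    uniqueness, each map [A' \sqcup B' -> D_k] is first replaced by a
    cofibration [A' \sqcup B' -> E_k]; gluing [E_1] and [E_2] along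
    [A' \sqcup B'] produces a solution that receives maps from both. *)

Set Implicit Arguments.
Unset Strict Implicit.
Unset Printing Implicit Defensive.

Lemma initial_eq (C : Category) (o a : C) (f g : Hom o a) :
  initial o -> f = g.
Proof.
  intros ho. destruct (ho a) as [h [_ u]].
  now rewrite <- (u f I), <- (u g I).
Qed.

Lemma initial_is_iso (C : Category) (o o' : C) (f : Hom o o') :
  initial o -> initial o' -> is_iso f.
Proof.
  intros ho ho'. destruct (ho' o) as [g _]. exists g.
  split; now apply initial_eq.
Qed.

Lemma pushout_eq (C : Category) (a b c d x : C) (f : Hom a b) (g : Hom a c)
    (p : Hom b d) (q : Hom c d) (w w' : Hom d x) :
  is_pushout f g p q -> w \c p = w' \c p -> w \c q = w' \c q -> w = w'.
Proof.
  intros [e U] ep eq. destruct (U x (w' \c p) (w' \c q)) as [h [_ u]].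
  - now rewrite <- !comp_assoc, e.
  - rewrite <- (u w (conj ep eq)). exact (u w' (conj eq_refl eq_refl)).
Qed.

Lemma pushout_iso (C : Category) (a b c d d' : C) (f : Hom a b) (g : Hom a c)
    (p : Hom b d) (q : Hom c d) (w : Hom d d') :
  is_pushout f g p q -> is_iso w -> is_pushout f g (w \c p) (w \c q).
Proof.
  intros P [v [vw wv]]. split.
  - destruct P as [e _]. now rewrite <- !comp_assoc, e.
  - intros x h k e. destruct (proj2 P x h k e) as [m [[mp mq] _]].
    exists (m \c v). split.
    + split.
      * now rewrite <- comp_assoc, (comp_assoc v), vw, comp_idl.
      * now rewrite <- comp_assoc, (comp_assoc v), vw, comp_idl.
    + intros n [np nq]. rewrite <- (comp_idr n), <- wv, comp_assoc. f_equal.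
      apply (pushout_eq P); rewrite <- comp_assoc; congruence.
Qed.

(** Cofibrancy of [a] provides a cofibration out of some initial object, possibly not [o]; the
    comparison of the two initial objects is an isomorphism with cofibrant domain, hence a
    cofibration by CF1. *)
Lemma initial_cof (C : Category) (W Cof : mor_class C) (o a : C)
    (f : Hom o a) :
  precofibration_category W Cof -> initial o -> cofibrant Cof o ->
  cofibrant Cof a -> Cof _ _ f.
Proof.
  intros HC ho co (o' & g & ho' & Cg).
  destruct (ho o') as [h _].
  rewrite (initial_eq f (g \c h) ho).
  apply (CF1_comp HC); trivial.
  apply (CF1_iso_cof HC); trivial. now apply initial_is_iso.
Qed.

(* [q] itself need not be inverted in [ho W]. *)
Lemma ho_fraction_eq (C : Category) (W : mor_class C) (a b d d' : C)
    (i : Hom a d) (j : Hom b d) (q : Hom d d') (i' : Hom a d') (j' : Hom b d')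
    (Wj : W _ _ j) (Wj' : W _ _ j') :
  q \c i = i' -> q \c j = j' ->
  ho_inv W Wj \c fhom (ho_loc W) i = ho_inv W Wj' \c fhom (ho_loc W) i'.
Proof.
  intros ei ej.
  assert (ho_inv W Wj = ho_inv W Wj' \c fhom (ho_loc W) q) as ->.
  { rewrite <- (comp_idr (ho_inv W Wj' \c _)), <- (ho_invr Wj), comp_assoc.
    rewrite <- (comp_assoc (ho_inv W Wj')), <- fhom_comp, ej, ho_invl.
    symmetry. apply comp_idl. }
  now rewrite <- comp_assoc, <- fhom_comp, ei.
Qed.

Section CofibrantApproximation.
Variables (M' M : Category) (W' Cof' : mor_class M') (W Cof : mor_class M).
Arguments W : clear implicits.
Arguments Cof : clear implicits.
Arguments W' : clear implicits.
Arguments Cof' : clear implicits.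
Variable t : Functor M' M.
Hypothesis HM : precofibration_category W Cof.
Hypothesis Ht : cofibrant_approximation W' Cof' W Cof t.

Let HM' : precofibration_category W' Cof' := CFA_precof Ht.

Lemma cofibrant_image (a : M') : cofibrant Cof (t a).
Proof.
  destruct (CFA_cofibrant Ht a) as (o & f & ho & Cf).
  exists (t o), (fhom t f).
  split; [now apply (CFA1_initial Ht)|now apply (CFA1_cof Ht)].
Qed.

(** CF3 yields some pushout of the image span, and CFA3 makes its comparison map to [t d] an
    isomorphism, along which the universal property is carried over. *)
Lemma pushout_image (a b c d : M') (f : Hom a b) (g : Hom a c)
    (p : Hom b d) (q : Hom c d) :
  Cof' _ _ f -> Cof' _ _ g -> is_pushout f g p q ->
  is_pushout (fhom t f) (fhom t g) (fhom t p) (fhom t q).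
Proof.
  intros Cf Cg P.
  destruct (CF3_exists HM (fhom t g) (CFA1_cof Ht Cf)
              (cofibrant_image a) (cofibrant_image c)) as (e & p1 & q1 & P1).
  destruct (proj2 P1 _ (fhom t p) (fhom t q)) as [w [[wp wq] _]].
  { now rewrite <- !fhom_comp, (proj1 P). }
  rewrite <- wp, <- wq. apply (pushout_iso P1).
  exact (CFA3 Ht Cf Cg P P1 wp wq).
Qed.

(** The equality [u \c f = v \c g] is recorded in [M'] itself, since uniqueness in LAP2 compares
    fractions there and [t] need not be faithful. *)
Lemma glue (x d1 d2 : M') (b : M) (f : Hom x d1) (g : Hom x d2)
    (s1 : Hom (t d1) b) (s2 : Hom (t d2) b) :
  Cof' _ _ f -> Cof' _ _ g -> s1 \c fhom t f = s2 \c fhom t g ->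
  exists (d : M') (u : Hom d1 d) (v : Hom d2 d) (r : Hom (t d) b),
    W _ _ r /\ u \c f = v \c g /\ r \c fhom t u = s1 /\ r \c fhom t v = s2.
Proof.
  intros Cf Cg e.
  destruct (CF3_exists HM' g Cf (CFA_cofibrant Ht x) (CFA_cofibrant Ht d2))
    as (y & p & q & P).
  destruct (proj2 (pushout_image Cf Cg P) _ s1 s2 e) as [w [[wp wq] _]].
  destruct (CFA4 Ht w) as (d & k & r & _ & Wr & ew).
  exists d, (k \c p), (k \c q), r. repeat split.
  - assumption.
  - now rewrite <- !comp_assoc, (proj1 P).
  - now rewrite fhom_comp, comp_assoc, <- ew.
  - now rewrite fhom_comp, comp_assoc, <- ew.
Qed.

Lemma initial_cofibrations (a b : M') :
  exists (o : M') (f : Hom o a) (g : Hom o b),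
    initial o /\ Cof' _ _ f /\ Cof' _ _ g.
Proof.
  destruct (CF1_initial HM') as (o & ho & co).
  destruct (ho a) as [f _], (ho b) as [g _].
  exists o, f, g. repeat split; trivial;
    apply (initial_cof _ HM' ho co), (CFA_cofibrant Ht).
Qed.

(** Two out of three holds in [M], and CFA2 reflects the result to [M']. *)
Lemma weq_leg (b' d : M') (b : M) (j : Hom b' d) (s : Hom (t d) b)
    (p : Hom (t b') b) :
  W _ _ p -> W _ _ s -> s \c fhom t j = p -> W' _ _ j.
Proof.
  intros Wp Ws e. apply (CFA2 Ht), (CF2_right HM Ws). now rewrite e.
Qed.

Lemma left_approximation_of_cofibrant_approximation :
  left_approximation W' W t.
Proof.
  split.
  - intros a b f. apply (CFA2 Ht).
  (* LAP1: CFA4 factors the unique map [t o -> a], whose source is initial by CFA1. *)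
  - intros a. destruct (CF1_initial HM') as (o & ho & _).
    destruct (CFA1_initial Ht ho a) as [f _].
    destruct (CFA4 Ht f) as (a' & _ & r & _ & Wr & _). now exists a', r.
  - intros a' b' b f p Wp.
    destruct (initial_cofibrations a' b') as (o & k & l & ho & Ck & Cl).
    destruct (@glue _ _ _ _ _ _ f p Ck Cl) as (d & i & j & s & Ws & _ & ei & ej).
    { apply initial_eq. now apply (CFA1_initial Ht). }
    exists d, i, j, s. repeat split; trivial. exact (weq_leg Wp Ws ej).
  - intros a' b' b f p Wp d1 i1 j1 s1 d2 i2 j2 s2 Wj1 Wj2 Ws1 f1 p1 Ws2 f2 p2.
    destruct (initial_cofibrations a' b') as (o & k & l & ho & Ck & Cl).
    (* [c] is the coproduct of [a'] and [b'], with injections [ia] and [ib]. *)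
    destruct (CF3_exists HM' l Ck (CFA_cofibrant Ht o) (CFA_cofibrant Ht b'))
      as (c & ia & ib & P).
    (* Factoring the induced map [c -> d] by CF4 gives a solution on [e] whose map [h] from [c] is a
       cofibration, as gluing requires; [q] maps it to the given solution, so both define the same
       fraction. *)
    assert (forall (d : M') (i : Hom a' d) (j : Hom b' d) (s : Hom (t d) b),
      W _ _ s -> s \c fhom t i = f -> s \c fhom t j = p ->
      exists (e : M') (h : Hom c e) (q : Hom e d),
        Cof' _ _ h /\ W _ _ (s \c fhom t q) /\
        q \c (h \c ia) = i /\ q \c (h \c ib) = j /\
        (s \c fhom t q) \c fhom t (h \c ia) = f /\
        (s \c fhom t q) \c fhom t (h \c ib) = p) as R.
    { intros d i j s Ws fi pj.
      destruct (proj2 P _ i j (initial_eq _ _ ho)) as [w [[wi wj] _]].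
      destruct (CF4 HM' w (CFA_cofibrant Ht c)) as (e & h & q & Ch & Wq & ew).
      assert (q \c (h \c ia) = i) as ei by now rewrite comp_assoc, <- ew.
      assert (q \c (h \c ib) = j) as ej by now rewrite comp_assoc, <- ew.
      exists e, h, q. repeat split; trivial.
      - apply (CF2_comp HM); trivial. now apply (CFA2 Ht).
      - now rewrite <- comp_assoc, <- fhom_comp, ei.
      - now rewrite <- comp_assoc, <- fhom_comp, ej. }
    destruct (R _ _ _ _ Ws1 f1 p1) as (e1 & h1 & q1 & C1 & V1 & x1 & y1 & F1 & P1).
    destruct (R _ _ _ _ Ws2 f2 p2) as (e2 & h2 & q2 & C2 & V2 & x2 & y2 & F2 & P2).
    destruct (@glue _ _ _ _ _ _ (s1 \c fhom t q1) (s2 \c fhom t q2) C1 C2)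
      as (d & u & v & r & Wr & uv & ru & rv).
    (* Since [t c] is the coproduct of [t a'] and [t b'], it suffices to compare on the two
       summands, where both maps restrict to [f] and [p]. *)
    { apply (pushout_eq (pushout_image Ck Cl P));
        rewrite <- comp_assoc, <- fhom_comp, ?F1, ?P1;
        rewrite <- comp_assoc, <- fhom_comp; congruence. }
    pose proof (weq_leg Wp V1 P1) as K1.
    pose proof (weq_leg Wp V2 P2) as K2.
    assert (W' _ _ (u \c (h1 \c ib))) as K.
    { apply (weq_leg Wp Wr). now rewrite fhom_comp, comp_assoc, ru. }
    (* Both fractions move back along [q1] and [q2] to [e1] and [e2], then forward along [u] and [v]
       to the common object [d]. *)
    rewrite <- (ho_fraction_eq K1 Wj1 x1 y1), <- (ho_fraction_eq K2 Wj2 x2 y2).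
    rewrite (ho_fraction_eq K1 K eq_refl eq_refl).
    symmetry. apply (@ho_fraction_eq _ _ _ _ _ _ _ _ v);
      now rewrite !comp_assoc, uv.
Qed.

End CofibrantApproximation.

Theorem theorem6p1p5 :
  (forall (M' M : Category) (W' Cof' : mor_class M') (W Cof : mor_class M)
      (t : Functor M' M),
    precofibration_category W Cof ->
    cofibrant_approximation W' Cof' W Cof t ->
    left_approximation W' W t) /\
  (forall (M' M : Category) (W' Fib' : mor_class M') (W Fib : mor_class M)
      (t : Functor M' M),
    prefibration_category W Fib ->
    fibrant_approximation W' Fib' W Fib t ->
    right_approximation W' W t).
Proof.
  (* The fibrant notions unfold to the cofibrant ones for the opposite categories and [fop t], so
     one lemma proves both halves. *)
  split; intros M' M W' C' W C t HM Ht;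
    exact (left_approximation_of_cofibrant_approximation HM Ht).
Qed.
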